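(* For every integer $n \geq 3$, $m(n) \geq n-1$, where $m(n)$ is the maximum sort-number (with respect to the map $SC_{231}$) among all permutations in $S_n$.
   Context: Permutations $p \in S_n$ are written in one-line notation as words $p(1)p(2)\cdots p(n)$. A permutation contains a pattern $\sigma\in S_k$ if it has a (not necessarily contiguous) subsequence of $k$ entries in the same relative order as $\sigma$; otherwise it avoids $\sigma$. A sequence of distinct numbers contains $\sigma$ consecutively if some $k$ contiguous entries are in the same relative order as $\sigma$. $\mathrm{Av}_n(132,231)$ is the set of permutations in $S_n$ avoiding both $132$ and $231$ (equivalently, permutations having no index $1<i<n$ with $p(i-1)<p(i)>p(i+1)$). The map $SC_{231}: S_n \to S_n$ is defined by passing $p$ through a stack: the entries of $p$ are the input, read left to right; the stack and output start empty. While the input is nonempty, let $x$ be the next input entry. If, after pushing $x$ on top of the stack, the stack contents read from top to bottom would not contain $231$ consecutively, then push $x$; otherwise pop the top entry of the stack and append it to the right end of the output (and repeat with the same $x$). When the input is empty, pop all remaining stack entries from top to bottom, appending each to the output. The resulting output word is $SC_{231}(p)$. For example $SC_{231}(45231)=13254$ and $SC_{231}(132)=321$. The sort-number of $p \in S_n$ is the minimum integer $k \geq 0$ such that $SC_{231}^k(p) \in \mathrm{Av}_n(132,231)$, where $SC_{231}^k$ is the $k$-fold iterate (such a $k$ exists for every $p$). *)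

(* Defs.v *)
From mathcomp Require Import all_boot all_fingroup.
From mathcomp Require Import zify.

Set Implicit Arguments.
Unset Strict Implicit.
Unset Printing Implicit Defensive.

(* Only meaningful for sequences of distinct numbers. *)
Definition same_order (s t : seq nat) : bool :=
  (size s == size t) &&
  [forall i : 'I_(size s), forall j : 'I_(size s),
     (nth 0 s i < nth 0 s j) == (nth 0 t i < nth 0 t j)].

Definition contains (sigma w : seq nat) : bool :=
  [exists m : (size w).-tuple bool, same_order (mask m w) sigma].

Definition avoids (sigma w : seq nat) : bool := ~~ contains sigma w.

Definition contains_consec (sigma w : seq nat) : bool :=
  [exists i : 'I_(size w).+1, same_order (take (size sigma) (drop i w)) sigma].

(* Stacks are listed from top to bottom.  The result is the pair (stack, output)
   reached once x has been pushed.  A stack reduced to x is always acceptable,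
   sigma having length at least 2. *)
Fixpoint push_entry (sigma : seq nat) (x : nat) (stack output : seq nat) :
    seq nat * seq nat :=
  if stack is y :: stack' then
    if contains_consec sigma (x :: stack)
    then push_entry sigma x stack' (rcons output y)
    else (x :: stack, output)
  else ([:: x], output).

Definition stack_run (sigma input : seq nat) : seq nat * seq nat :=
  foldl (fun so x => push_entry sigma x so.1 so.2) ([::], [::]) input.

Definition SC_word (sigma input : seq nat) : seq nat :=
  let so := stack_run sigma input in so.2 ++ so.1.

(* One-line notation, with entries 0, ..., n-1 instead of 1, ..., n (relative
   order, hence patterns and stack-sorting, are insensitive to the shift). *)
Definition word n (p : 'S_n) : seq nat := [seq val (p i) | i <- enum 'I_n].

Lemma size_word n (p : 'S_n) : size (word p) = n.
Proof. by rewrite size_map size_enum_ord. Qed.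

Lemma nth_word n (p : 'S_n) (i : 'I_n) : nth 0 (word p) i = p i.
Proof. by rewrite (nth_map i) ?size_enum_ord // nth_ord_enum. Qed.

Lemma word_uniq n (p : 'S_n) : uniq (word p).
Proof.
rewrite map_inj_uniq ?enum_uniq //.
by move=> i j /val_inj /perm_inj.
Qed.

Lemma word_lt n (p : 'S_n) : all (fun x => x < n) (word p).
Proof. by apply/allP => x /mapP [i _ ->]; exact: ltn_ord. Qed.

Lemma perm_push_entry sigma x s o :
  perm_eq ((push_entry sigma x s o).2 ++ (push_entry sigma x s o).1)
          (x :: o ++ s).
Proof.
elim: s o => [|y s IH] o /=; first by rewrite cats0 perm_catC.
case: ifP => _; last by rewrite -cat1s perm_catCA.
by rewrite (permPl (IH _)) cat_rcons.
Qed.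

Lemma perm_SC_word sigma w : perm_eq (SC_word sigma w) w.
Proof.
rewrite /SC_word /stack_run; elim/last_ind: w => [|w x IH] //.
rewrite foldl_rcons (permPl (perm_push_entry _ _ _ _)).
by rewrite perm_sym perm_rcons perm_cons perm_sym.
Qed.

Definition SC_fun sigma n (p : 'S_n) (i : 'I_n) : 'I_n :=
  insubd i (nth 0 (SC_word sigma (word p)) i).

Lemma size_SC_word sigma w : size (SC_word sigma w) = size w.
Proof. exact/perm_size/perm_SC_word. Qed.

Lemma SC_funE sigma n (p : 'S_n) i :
  SC_fun sigma p i = nth 0 (SC_word sigma (word p)) i :> nat.
Proof.
rewrite val_insubd; case: ifPn => // /negP []; have := word_lt p.
rewrite -(perm_all _ (perm_SC_word sigma _)) => /allP; apply.
by rewrite mem_nth // size_SC_word size_word.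
Qed.

Lemma SC_fun_inj sigma n (p : 'S_n) : injective (SC_fun sigma p).
Proof.
move=> i j /(congr1 val) /=; rewrite !SC_funE => /eqP.
rewrite nth_uniq ?size_SC_word ?size_word //; last first.
  by rewrite (perm_uniq (perm_SC_word _ _)) word_uniq.
by move/eqP/val_inj.
Qed.

Definition SC sigma n (p : 'S_n) : 'S_n := perm (@SC_fun_inj sigma n p).

Lemma word_SC sigma n (p : 'S_n) : word (SC sigma p) = SC_word sigma (word p).
Proof.
apply: (@eq_from_nth _ 0); rewrite ?size_SC_word !size_word // => i lt_i_n.
by rewrite -[i]/(val (Ordinal lt_i_n)) nth_word permE SC_funE.
Qed.

Definition SC231 n (p : 'S_n) : 'S_n := SC [:: 2; 3; 1] p.

Definition Av_132_231 n : {set 'S_n} :=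
  [set p | avoids [:: 1; 3; 2] (word p) && avoids [:: 2; 3; 1] (word p)].

(* Every permutation is eventually sent to Av(132, 231): reading p outwards from
   its minimum, to the left and to the right, the sum of the lexicographic codes
   of the two words decreases whenever an entry is popped before the input is
   exhausted; if no entry is, then SC231 reverses p. *)

Lemma same_orderP s t :
  reflect (size s = size t /\ forall i j, i < size s -> j < size s ->
             (nth 0 s i < nth 0 s j) = (nth 0 t i < nth 0 t j))
          (same_order s t).
Proof.
apply: (iffP andP) => [[/eqP -> /forallP h]|[-> h]]; split=> //.
  move=> i j hi hj.
  by have /forallP /(_ (Ordinal hj)) /eqP := h (Ordinal hi).
by apply/forallP => i; apply/forallP => j; apply/eqP; apply: h.
Qed.

Lemma same_order231 s :
  same_order s [:: 2; 3; 1] ->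
  exists b a x, s = [:: b; a; x] /\ x < b < a.
Proof.
move/same_orderP; case: s => [|b [|a [|x [|? ?]]]] [] //= _ h.
exists b, a, x; split=> //.
by have /= := h 2 0 isT isT; have /= := h 0 1 isT isT => -> ->.
Qed.

Lemma same_order132 s :
  same_order s [:: 1; 3; 2] ->
  exists b a x, s = [:: b; a; x] /\ b < x < a.
Proof.
move/same_orderP; case: s => [|b [|a [|x [|? ?]]]] [] //= _ h.
exists b, a, x; split=> //.
by have /= := h 0 2 isT isT; have /= := h 2 1 isT isT => -> ->.
Qed.

Lemma same_order231_of b a x :
  x < b < a -> same_order [:: b; a; x] [:: 2; 3; 1].
Proof.
move=> h; apply/same_orderP; split=> // -[|[|[|i]]] [|[|[|j]]] //= _ _; lia.
Qed.

Local Notation cc := (contains_consec [:: 2; 3; 1]).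

Lemma cc_cons x s :
  cc (x :: s) = (if s is a :: b :: _ then b < x < a else false) || cc s.
Proof.
apply/existsP/orP => [[[i /= hi]]|].
  case: i hi => [|i] hi /=.
    move/same_order231 => [b [a [y []]]].
    case: s hi => [|a' [|b' s]] hi //= [-> -> ->] h; left; lia.
  by move=> h; right; apply/existsP; exists (Ordinal (hi : i < (size s).+1)).
case=> [|/existsP [[i hi] h]].
  case: s => [|a [|b s]] // h; exists ord0 => /=; rewrite take0.
  exact: same_order231_of.
by exists (Ordinal (hi : i.+1 < (size (x :: s)).+1)).
Qed.

Lemma cc_nil : cc [::] = false.
Proof.
by apply/negbTE/negP => /existsP [i /same_order231 [? [? [? []]]]].
Qed.

Lemma push_entry231 x s o : ~~ cc s ->
  push_entry [:: 2; 3; 1] x s o =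
  if s is a :: b :: r then
    if b < x < a then (x :: b :: r, rcons o a) else (x :: s, o)
  else (x :: s, o).
Proof.
case: s => [|a [|b r]] // hs; first by rewrite /push_entry !cc_cons cc_nil.
have hbr : ~~ cc (b :: r) by move: hs; rewrite cc_cons => /norP [].
have pushE y t u : push_entry [:: 2; 3; 1] x (y :: t) u =
    if cc (x :: y :: t) then push_entry [:: 2; 3; 1] x t (rcons u y)
    else (x :: y :: t, u) by [].
rewrite pushE cc_cons (negbTE hs) orbF; case: ifP => // /andP [bx xa].
rewrite pushE cc_cons (negbTE hbr) orbF.
by case: r {hs hbr} => // c r; case: ifP => //; lia.
Qed.

Lemma push_entry231_cc x s o : ~~ cc s ->
  ~~ cc (push_entry [:: 2; 3; 1] x s o).1.
Proof.
move=> hs; rewrite push_entry231 //.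
case: s hs => [|a [|b r]] hs; first by rewrite cc_cons cc_nil.
  by rewrite /= cc_cons.
case: ifP => h; last by rewrite /= cc_cons h.
move: hs; rewrite cc_cons => /norP [_ hbr].
rewrite /= cc_cons (negbTE hbr) orbF.
by case: r {hbr} => // c r; lia.
Qed.

Local Notation run := (stack_run [:: 2; 3; 1]).

Lemma run_rcons w x :
  run (rcons w x) = push_entry [:: 2; 3; 1] x (run w).1 (run w).2.
Proof. by rewrite /stack_run foldl_rcons. Qed.

Lemma run_cc w : ~~ cc (run w).1.
Proof.
elim/last_ind: w => [|w x IH]; first by rewrite cc_nil.
by rewrite run_rcons push_entry231_cc.
Qed.

Definition lexlt (s t : seq nat) : Prop :=
  exists p a b u v, [/\ s = p ++ a :: u, t = p ++ b :: v & a < b].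

Lemma lexlt_cat s t u v : lexlt s t -> lexlt (s ++ u) (t ++ v).
Proof.
case=> [p [a [b [s' [t' [-> -> h]]]]]].
by exists p, a, b, (s' ++ u), (t' ++ v); rewrite -!catA.
Qed.

Lemma lexlt_cons x s t : lexlt s t -> lexlt (x :: s) (x :: t).
Proof.
by case=> [p [a [b [u [v [-> -> h]]]]]]; exists (x :: p), a, b, u, v.
Qed.

Lemma lexlt_last u a x t :
  lexlt (rcons u a) t -> x < a -> lexlt (rcons u x) t.
Proof.
case=> [p [c [b [u' [v [E -> cb]]]]]] xa.
case/lastP: u' E => [|u' y].
  rewrite cats1 => /rcons_inj [-> ac].
  by exists p, x, b, [::], v; split; rewrite ?cats1 //; lia.
rewrite -rcons_cons -rcons_cat => /rcons_inj [-> _].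
by exists p, c, b, (rcons u' x), v; split; rewrite // -rcons_cons rcons_cat.
Qed.

Lemma run_left l :
  ((run l).2 = [::] /\ (run l).1 = rev l) \/ lexlt (run l).1 (rev l).
Proof.
elim/last_ind: l => [|l x IH]; first by left.
rewrite run_rcons push_entry231 ?run_cc // rev_rcons.
have hpush : ((run l).2 = [::] /\ x :: (run l).1 = x :: rev l)
              \/ lexlt (x :: (run l).1) (x :: rev l).
  by case: IH => [[-> ->]|h]; [left | right; exact: lexlt_cons].
have hd : forall a s, (run l).1 = a :: s -> exists v, rev l = a :: v.
  case/lastP: (l) => [//|l' y] a s.
  rewrite run_rcons push_entry231 ?run_cc // rev_rcons.
  move=> E; exists (rev l'); congr cons; move: E.
  case: (run l').1 => [|? [|? ?]] /=; first by case.
    by case.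
  by case: ifP => _ [].
case E: (run l).1 (hd) hpush => [|a [|b r]] //= {}hd hpush.
case: ifP => // /andP [bx xa]; right.
have [v ->] := hd _ _ (erefl _).
by exists [:: x], b, a, r, v; split=> //; lia.
Qed.

Lemma run_right l m r : all (fun x => m < x) l -> all (fun x => m < x) r ->
  exists t o, [/\ (run (l ++ m :: r)).1 = t ++ m :: (run l).1,
    (run (l ++ m :: r)).2 = (run l).2 ++ o,
    all (fun x => m < x) t &
    (o = [::] /\ rev t = r) \/ lexlt (rev t) r].
Proof.
move=> hl; elim/last_ind: r => [_|r x IH].
  exists [::], [::]; rewrite cats1 run_rcons push_entry231 ?run_cc // !cats0.
  have hS : all (fun x => m < x) (run l).1.
    apply/allP => y hy; apply: (allP hl).
    rewrite -(perm_mem (perm_SC_word [:: 2; 3; 1] l)) /SC_word mem_cat hy.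
    by rewrite orbT.
  case: (run l).1 hS => [|a [|b s]] /=; [by split; auto|by split; auto|].
  move=> /and3P [h1 h2 h3]; case: ifP => h; last by split; auto.
  by exfalso; lia.
rewrite all_rcons => /andP [mx /IH [t [o [E1 E2 ht ho]]]].
rewrite -rcons_cons -rcons_cat run_rcons push_entry231 ?run_cc // E1 E2.
have hpush : (o = [::] /\ rev (x :: t) = rcons r x)
             \/ lexlt (rev (x :: t)) (rcons r x).
  rewrite rev_cons; case: ho => [[-> ->]|h]; [by left|right].
  by rewrite -!cats1; exact: lexlt_cat.
have keep : exists t0 o0,
  [/\ x :: t ++ m :: (run l).1 = t0 ++ m :: (run l).1,
      (run l).2 ++ o = (run l).2 ++ o0, all (fun y => m < y) t0 &
      o0 = [::] /\ rev t0 = rcons r x \/ lexlt (rev t0) (rcons r x)].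
  by exists (x :: t), o; split=> //=; rewrite mx.
case: t ht ho {E1} hpush keep => [|a t] ht ho hpush keep /=.
  case: (run l).1 keep => [|b s] //= keep.
  by case: ifP => // h; exfalso; lia.
have xt : x < a -> lexlt (rev (x :: t)) (rcons r x).
  move=> xa; case: ho => [[_ <-]|h].
    rewrite !rev_cons -!cats1 -!catA /=.
    by exists (rev t), x, a, [::], [:: x].
  move: h; rewrite !rev_cons => h.
  by rewrite -[rcons (rev t) x]cats0 -[rcons r x]cats1;
     apply: lexlt_cat; exact: lexlt_last h xa.
have {}ht : all (fun y => m < y) t by case/andP: ht.
case: t ht xt {ho hpush} keep => [|b t] ht xt keep /=; case: ifP => // /andP [h1 h2].
  exists [:: x], (rcons o a); rewrite rcons_cat /= mx; split=> //.
  by right; apply: xt.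
exists [:: x, b & t], (rcons o a); rewrite rcons_cat /= mx; split=> //.
by right; apply: xt.
Qed.

(* Missing letters, beyond the end of s, are read as the largest digit N. *)
Fixpoint lexcode (N k : nat) (s : seq nat) : nat :=
  if k is k'.+1 then head N s * N.+1 ^ k' + lexcode N k' (behead s) else 0.

Lemma lexcode_lt N k s : all (fun x => x < N) s -> lexcode N k s < N.+1 ^ k.
Proof.
elim: k s => [|k IH] s hs //=; rewrite expnS.
have hh : head N s <= N by case: s hs => //= x s /andP [/ltnW].
have hb : all (fun x => x < N) (behead s) by case: s hs {hh} => //= x s /andP [].
have := IH _ hb; nia.
Qed.

Lemma lexcode_lexlt N k s t :
  all (fun x => x < N) s -> all (fun x => x < N) t -> size t <= k ->
  lexlt s t -> lexcode N k s < lexcode N k t.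
Proof.
move=> hs ht hk [p [a [b [u [v [Es Et ab]]]]]]; subst s t.
elim: p k hk hs ht => [|x p IH] [|k] //= hk /andP [h1 h2] /andP [h3 h4].
  by have := lexcode_lt k h2; have := lexcode_lt k h4; nia.
by rewrite ltn_add2l; exact: IH.
Qed.

Lemma lexcode_nil N k : (lexcode N k [::]).+1 = N.+1 ^ k.
Proof. by elim: k => [|k IH] //=; rewrite expnS -IH; nia. Qed.

Lemma lexcode_cat N k s t : all (fun x => x < N) (s ++ t) ->
  lexcode N k (s ++ t) <= lexcode N k s.
Proof.
elim: s k => [|x s IH] k h.
  by have := lexcode_lt k h; rewrite -lexcode_nil ltnS.
case: k => //= k; rewrite leq_add2l; apply: IH.
by case/andP: h.
Qed.

Definition potential n (p : 'S_n) : nat :=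
  let w := word p in
  lexcode n n (rev (take (index 0 w) w)) + lexcode n n (drop (index 0 w).+1 w).

Lemma word_perm_iota n (p : 'S_n) : perm_eq (word p) (iota 0 n).
Proof.
apply: uniq_perm; rewrite ?word_uniq ?iota_uniq // => x; rewrite mem_iota.
apply/mapP/idP => [[i _ ->]|]; first exact: ltn_ord.
move=> /= hx; exists (p^-1%g (Ordinal hx)); first exact: mem_enum.
by rewrite permKV.
Qed.

Lemma word_split n (p : 'S_n.+1) : exists l r,
  [/\ word p = l ++ 0 :: r, all (fun x => 0 < x) l, all (fun x => 0 < x) r &
      potential p = lexcode n.+1 n.+1 (rev l) + lexcode n.+1 n.+1 r].
Proof.
have h0 : 0 \in word p by rewrite (perm_mem (word_perm_iota p)) mem_iota.
move: (word_uniq p) (erefl (potential p)); rewrite {2}/potential.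
case/splitPr: h0 => l r.
rewrite cat_uniq /= negb_or => /and3P [_ /andP [hl _] /andP [hr _]].
have idx : index 0 (l ++ 0 :: r) = size l.
  by rewrite index_cat (negbTE hl) /= addn0.
rewrite idx take_size_cat // -cat_rcons drop_size_cat ?size_rcons // => ->.
exists l, r; rewrite cat_rcons; split=> //; apply/allP => x hx; rewrite lt0n.
  by apply: contraNneq hl => <-.
by apply: contraNneq hr => <-.
Qed.

Lemma potential_word n (p : 'S_n.+1) l r : word p = l ++ 0 :: r ->
  potential p = lexcode n.+1 n.+1 (rev l) + lexcode n.+1 n.+1 r.
Proof.
move=> E; have := word_uniq p; rewrite E cat_uniq /= negb_or.
case/and3P => _ /andP [hl _] _; rewrite /potential E.
have -> : index 0 (l ++ 0 :: r) = size l.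
  by rewrite index_cat (negbTE hl) /= addn0.
by rewrite take_size_cat // -cat_rcons drop_size_cat ?size_rcons.
Qed.

Lemma SC231_step n (p : 'S_n.+1) :
  [/\ word (SC231 p) = rev (word p), ~~ cc (rev (word p)) &
      potential (SC231 p) = potential p]
  \/ potential (SC231 p) < potential p.
Proof.
have [l [r [E hl hr ->]]] := word_split p.
have [t [o [E1 E2 ht ho]]] := run_right hl hr.
have Ew : word (SC231 p) = ((run l).2 ++ o ++ t) ++ 0 :: (run l).1.
  by rewrite word_SC E /SC_word E1 E2 -!catA.
have Ep := potential_word Ew.
have := word_lt p; have := word_lt (SC231 p).
have := size_word p; have := size_word (SC231 p).
rewrite E Ew !(size_cat, all_cat) /= => sz1 sz2.
move=> /andP [/and3P [a1 a2 a3] a4] /andP [b1 b2].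
have c1 : lexcode n.+1 n.+1 (rev ((run l).2 ++ o ++ t))
          <= lexcode n.+1 n.+1 (rev t).
  by rewrite !rev_cat -!catA lexcode_cat // !all_cat !all_rev a1 a2 a3.
rewrite Ep.
have b1' : all (fun x => x < n.+1) (rev l) by rewrite all_rev.
have a3' : all (fun x => x < n.+1) (rev t) by rewrite all_rev.
have szl : size (rev l) <= n.+1 by rewrite size_rev; lia.
have szr : size r <= n.+1 by lia.
case: (run_left l) ho => [[O1 S1]|/(lexcode_lexlt a4 b1' szl) h1]
    [[o1 t1]|/(lexcode_lexlt a3' b2 szr) h2].
- have Er : rev (l ++ 0 :: r) = t ++ 0 :: (run l).1.
    by rewrite S1 rev_cat rev_cons -t1 revK cat_rcons.
  left; rewrite Er O1 o1 /=; split=> //; first by rewrite -E1 run_cc.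
  by rewrite -t1 -S1 addnC.
- by right; rewrite S1 addnC ltn_add2l; exact: leq_ltn_trans c1 h2.
- by right; rewrite -t1 addnC -addSn; exact: leq_add h1 c1.
- by right; rewrite addnC -addSn leq_add // ltnW // (leq_ltn_trans c1).
Qed.

Definition nopeak (w : seq nat) : Prop :=
  forall i, i.+2 < size w ->
    nth 0 w i < nth 0 w i.+1 -> nth 0 w i.+1 < nth 0 w i.+2.

Lemma cc_nth w i : ~~ cc w -> i.+2 < size w ->
  ~~ (nth 0 w i.+2 < nth 0 w i < nth 0 w i.+1).
Proof.
elim: w i => [|x w IH] //= i; rewrite cc_cons => /norP [h1 h2].
case: i => [|i]; last exact: IH.
by case: w h1 {IH h2} => [|a [|b w]].
Qed.

Lemma cc_nopeak w : uniq w -> ~~ cc w -> ~~ cc (rev w) -> nopeak w.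
Proof.
move=> uw h1 h2 i hi lt01.
have := cc_nth h1 hi.
have Ew : size w = (size w - i.+3) + i.+3 by rewrite subnK.
set k := size w - i.+3 in Ew.
have hj : k.+2 < size (rev w) by rewrite size_rev Ew -addn3 leq_add2l.
have hi1 : i.+1 < size w := ltnW hi.
have hi0 : i < size w := ltnW hi1.
have := cc_nth h2 hj; rewrite size_rev in hj.
rewrite !nth_rev ?(ltnW (ltnW hj)) ?(ltnW hj) // Ew.
have -> : k + i.+3 - k.+3 = i by lia.
have -> : k + i.+3 - k.+2 = i.+1 by lia.
have -> : k + i.+3 - k.+1 = i.+2 by lia.
have : nth 0 w i != nth 0 w i.+2 by rewrite nth_uniq //; apply/eqP; lia.
have : nth 0 w i.+1 != nth 0 w i.+2 by rewrite nth_uniq //; apply/eqP; lia.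
move: lt01; move: (nth 0 w i) (nth 0 w i.+1) (nth 0 w i.+2) => u v t; lia.
Qed.

Lemma nopeak_behead x w : nopeak (x :: w) -> nopeak w.
Proof. by move=> h i; exact: (h i.+1). Qed.

Lemma nopeak_path c d w : nopeak (c :: d :: w) -> c < d -> path ltn c (d :: w).
Proof.
elim: w c d => [|e w IH] c d h cd /=; first by rewrite cd.
rewrite cd; apply: (IH d e); first exact: nopeak_behead h.
exact: (h 0).
Qed.

Lemma nopeak_subseq2 b a x w : nopeak (b :: w) -> subseq [:: a; x] w ->
  b < a -> a < x.
Proof.
elim: w b => [|d w IH] b // h hs ba; case: (ltnP b d) => bd.
  have := nopeak_path h bd; move/path_sorted => /(subseq_sorted ltn_trans hs).
  by rewrite /= andbT.
apply: (IH d) => //; [exact: nopeak_behead h | | lia].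
by move: hs => /=; case: eqP => // ad; lia.
Qed.

Lemma nopeak_subseq3 b a x w : nopeak w -> subseq [:: b; a; x] w ->
  b < a -> a < x.
Proof.
elim: w => [|d w IH] // h.
rewrite [subseq _ _]/=; case: eqP => [bd|_] hs ba.
  by apply: nopeak_subseq2 hs ba; rewrite bd.
by apply: IH => //; exact: nopeak_behead h.
Qed.

Lemma cc_Av n (p : 'S_n) : ~~ cc (word p) -> ~~ cc (rev (word p)) ->
  p \in Av_132_231 n.
Proof.
move=> h1 h2; have h := cc_nopeak (word_uniq p) h1 h2.
rewrite inE; apply/andP; split; apply/negP => /existsP [m].
  move/same_order132 => [b [a [x [E ?]]]].
  have := mask_subseq m (word p); rewrite E => /(nopeak_subseq3 h); lia.
move/same_order231 => [b [a [x [E ?]]]].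
have := mask_subseq m (word p); rewrite E => /(nopeak_subseq3 h); lia.
Qed.

Lemma sortable n (p : 'S_n) :
  exists k, iter k (@SC231 n) p \in Av_132_231 n.
Proof.
case: n p => [|n] p.
  exists 0; apply: cc_Av => /=;
    by rewrite (size0nil (size_word p)) ?cc_nil.
move: {2}(potential p).+1 (ltnSn (potential p)) => N.
elim: N p => [|N IH] p // hp.
have [[w1 c1 p1]|h1] := SC231_step p; last first.
  have [k hk] : exists k, iter k (@SC231 _) (SC231 p) \in Av_132_231 n.+1.
    by apply: IH; lia.
  by exists k.+1; rewrite iterSr.
have [[w2 c2 p2]|h2] := SC231_step (SC231 p); last first.
  have [k hk] : exists k,
      iter k (@SC231 _) (SC231 (SC231 p)) \in Av_132_231 n.+1.
    by apply: IH; lia.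
  by exists k.+2; rewrite !iterSr.
by exists 0; apply: cc_Av => //; move: c2; rewrite w1 revK.
Qed.

Definition sort_number n (p : 'S_n) : nat := ex_minn (sortable p).

Definition max_sort_number n : nat := \max_(p : 'S_n) sort_number p.

(* Main.v *)
(* Entries are 0, ..., n-1.  If a permutation contains the contiguous factor
   2 4 ... 2k (2k-1) ... 3 1 0, its image contains the factor
   0 1 3 ... (2k-1) (2k-2) ... 4 2, and the image of the latter contains
   2 4 ... (2k-2) (2k-3) ... 3 1 0, whatever the entries around the factor are:
   each pass pops only the peak of the factor, and nothing below it on the
   stack is uncovered later.  A factor with a peak contains 132.  For n >= 4, a
   factor that is a whole permutation appears after two passes on
     (2k-1) 2k ... 3 4 1 2 0          if n = 2k+1,
     0 2 1 4 3 ... 2k (2k-1) (2k+1)   if n = 2k+2,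
   and it still has a peak after n-2 passes.  Finally Av(132, 231) is stable,
   since SC231 acts on it by reversal. *)

Require Import Defs.
From mathcomp Require Import all_boot all_fingroup.
From mathcomp Require Import zify.

(** * The stack pass as a fold, and inputs that pop nothing *)

Local Notation cc := (contains_consec [:: 2; 3; 1]).
Local Notation SCw := (SC_word [:: 2; 3; 1]).

(** One pop per entry suffices on a stack free of consecutive 231: once [a] is gone, the top is
    [b < x], and [x], [b] cannot begin a 231. *)
Definition step231 (so : seq nat * seq nat) (x : nat) : seq nat * seq nat :=
  if so.1 is a :: b :: r then
    if b < x < a then (x :: b :: r, rcons so.2 a) else (x :: so.1, so.2)
  else (x :: so.1, so.2).

Lemma stack_run231 w :
  stack_run [:: 2; 3; 1] w = foldl step231 ([::], [::]) w.
Proof.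
elim/last_ind: w => [|w x IH] //.
rewrite run_rcons foldl_rcons -IH push_entry231 ?run_cc //.
Qed.

Lemma step231_0 s o : step231 (s, o) 0 = (0 :: s, o).
Proof. by rewrite /step231; case: s => [|a [|b r]]. Qed.

Lemma SCw_run w s o :
  foldl step231 ([::], [::]) w = (s, o) -> SCw w = o ++ s.
Proof. by rewrite /SC_word stack_run231 => ->. Qed.

Lemma foldl_step_cc w s o :
  ~~ cc (catrev w s) -> foldl step231 (s, o) w = (catrev w s, o).
Proof.
elim: w s o => [|x w IH] s o //= h.
(* Every intermediate stack is a suffix of the final one. *)
have hx : ~~ cc (x :: s).
  elim: w (x :: s) h {IH} => [|y w IHw] t //= /IHw.
  by rewrite cc_cons => /norP [].
rewrite -IH //; congr foldl; move: hx; rewrite /step231 cc_cons.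
by case: s {h} => [|a [|b r]] //= /norP [/negbTE ->].
Qed.

Lemma SCw_rev w : ~~ cc (rev w) -> SCw w = rev w.
Proof. by move=> h; rewrite (SCw_run _ _ _ (foldl_step_cc _ _ _ h)). Qed.

Lemma step231_push a s o x :
  a <= x -> step231 (a :: s, o) x = (x :: a :: s, o).
Proof.
by move=> ax; rewrite /step231; case: s => [|b r] //=; case: ifP => //; lia.
Qed.

Lemma foldl_step_up a w s o :
  path ltn a w -> foldl step231 (a :: s, o) w = (catrev w (a :: s), o).
Proof.
elim: w a s => [|x w IH] a s //= /andP [ax /IH <-].
by rewrite step231_push // ltnW.
Qed.

(** A pop needs an entry above the second stack entry; a decreasing run that starts below both top
    entries never provides one. *)
Lemma foldl_step_down a b w s o :
  path gtn (minn a b) w ->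
  foldl step231 (a :: b :: s, o) w = (catrev w (a :: b :: s), o).
Proof.
elim: w a b s => [|x w IH] a b s //= /andP [hx hw].
rewrite -IH; last by have -> : minn x a = x by lia.
by congr foldl; rewrite /step231 /=; case: ifP => //; lia.
Qed.

Lemma foldl_step_push w x s o : exists s' o',
  foldl step231 (s, o) (rcons w x) = (x :: s', o').
Proof.
rewrite foldl_rcons; case: (foldl _ _ w) => [[|a [|b r]] u]; rewrite /step231 /=.
- by exists [::], u.
- by exists [:: a], u.
by case: ifP => _; [exists (b :: r), (rcons u a) | exists [:: a, b & r], u].
Qed.

(* The entry c cannot be popped, because the entry b below it is at least c. *)
Lemma foldl_step_bottom t b c s o w : c <= b -> exists t' o',
  foldl step231 (t ++ [:: c, b & s], o) w = (t' ++ [:: c, b & s], o').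
Proof.
move=> cb; elim: w t o => [|x w IH] t o /=; first by exists t, o.
suff [t' [o' ->]] : exists t' o',
  step231 (t ++ [:: c, b & s], o) x = (t' ++ [:: c, b & s], o') by exact: IH.
rewrite /step231; case: t => [|a [|d t]] /=; case: ifP => h.
- by exfalso; lia.
- by exists [:: x], o.
- by exists [:: x], (rcons o a).
- by exists [:: x; a], o.
- by exists [:: x, d & t], (rcons o a).
- by exists [:: x, a, d & t], o.
Qed.

(** * Factors with a peak and their images *)

Fixpoint skip2 (c k : nat) : seq nat :=
  if k is k'.+1 then c :: skip2 c.+2 k' else [::].

Lemma skip2_rcons c k : skip2 c k.+1 = rcons (skip2 c k) (c + k.*2).
Proof.
elim: k c => [|k IH] c; first by rewrite /= addn0.
by rewrite [LHS]/= -[_ :: skip2 _ _]/(skip2 c.+2 k.+1) IH /= !addSn !addnS.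
Qed.

Lemma path_skip2 a c k : a < c -> path ltn a (skip2 c k).
Proof. by elim: k a c => [|k IH] a c //= ac; rewrite ac IH. Qed.

(** For [k > 0] the hypothesis says, without subtraction, that the largest entry [c + 2(k-1)] is
    below [m]. *)
Lemma path_rev_skip2 m c k :
  c + k.*2 < m.+2 -> path gtn m (rev (skip2 c k)).
Proof.
elim: k m => [|k IH] m // h.
by rewrite skip2_rcons rev_rcons /= IH ?andbT; lia.
Qed.

Arguments skip2 : simpl never.

Local Notation odds k := (skip2 1 k).
Local Notation evens k := (skip2 2 k).

(* 2 4 ... 2k (2k-1) ... 3 1 0 *)
Definition left_word k := evens k ++ rev (0 :: odds k).

(* 0 1 3 ... (2k-1) (2k-2) ... 4 2 *)
Definition right_word k := 0 :: odds k ++ rev (evens k.-1).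

(** The 2 is on the stack beforehand, as its arrival may pop an entry of the surroundings.
    Afterwards [s] is out of reach: the evens pile up, 2k+3 expels the peak 2k+4, and the decreasing
    rest pops nothing. *)
Lemma foldl_step_left s o k :
  foldl step231 (2 :: s, o) (behead (left_word k.+2)) =
    (right_word k.+2 ++ s, rcons o k.+2.*2).
Proof.
have -> : behead (left_word k.+2) =
    rcons (skip2 4 k.+1) k.+1.*2.+1 ++ rev (odds k.+1) ++ [:: 0].
  by rewrite /left_word (skip2_rcons 1 k.+1) rev_cons rev_rcons rcons_cons
    -cats1 cat_rcons.
have E : catrev (skip2 4 k.+1) (2 :: s) =
    [:: k.+2.*2, k.+1.*2 & rev (evens k) ++ s].
  rewrite -[LHS]/(catrev (evens k.+2) s) catrevE !(skip2_rcons 2).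
  by rewrite !rev_rcons.
rewrite foldl_cat foldl_rcons foldl_step_up ?path_skip2 // E.
set result := RHS; rewrite {2}/step231 /=.
have -> : k.+1.*2 < k.+1.*2.+1 < k.+2.*2 by lia.
rewrite foldl_cat foldl_step_down; last by apply: path_rev_skip2; lia.
rewrite catrevE revK [foldl _ _ _]step231_0 /result /right_word.
rewrite (skip2_rcons 1 k.+1) [k.+2.-1]/= (skip2_rcons 2) rev_rcons cat_rcons.
by rewrite /= -catA.
Qed.

Lemma SCw_left_word k w :
  infix (left_word k.+2) w -> infix (right_word k.+2) (SCw w).
Proof.
case/infixP => [z1 [z2 ->]].
have -> : left_word k.+2 = 2 :: behead (left_word k.+2) by [].
have [s [o E]] := foldl_step_push z1 2 [::] [::].
rewrite cat_cons -cat_rcons.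
have E2 : foldl step231 ([::], [::]) (rcons z1 2 ++ behead (left_word k.+2)) =
    ([::] ++ right_word k.+2 ++ s, rcons o k.+2.*2).
  by rewrite foldl_cat E foldl_step_left.
rewrite catA /SC_word stack_run231 foldl_cat E2.
(* The block has 0 1 on top, so 0 is never popped and shields the block while [z2] is read. *)
have [t [u ->]] := @foldl_step_bottom [::] 1 0
  (behead (behead (right_word k.+2)) ++ s) (rcons o k.+2.*2) z2 isT.
by apply/infixP; exists (u ++ t), s; rewrite -!catA.
Qed.

Lemma foldl_step_right s o k :
  foldl step231 (0 :: s, o) (behead (right_word k.+2)) =
    (left_word k.+1 ++ s, rcons o k.+1.*2.+1).
Proof.
have -> : behead (right_word k.+2) =
    rcons (odds k.+2) k.+1.*2 ++ rev (evens k).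
  by rewrite /right_word (skip2_rcons 2) rev_rcons cat_rcons.
have E : catrev (odds k.+2) (0 :: s) =
    [:: k.+1.*2.+1, k.*2.+1 & rev (odds k) ++ 0 :: s].
  by rewrite catrevE !(skip2_rcons 1) !rev_rcons.
rewrite foldl_cat foldl_rcons foldl_step_up ?path_skip2 // E.
set result := RHS; rewrite {2}/step231 /=.
have -> : k.*2.+1 < k.+1.*2 < k.+1.*2.+1 by lia.
rewrite foldl_step_down; last by apply: path_rev_skip2; lia.
rewrite catrevE revK /result /left_word !skip2_rcons rev_cons rev_rcons.
by rewrite -catA cat_rcons rcons_cons /= -(cats1 _ 0) -catA.
Qed.

Lemma SCw_right_word k w :
  infix (right_word k.+3) w -> infix (left_word k.+2) (SCw w).
Proof.
case/infixP => [z1 [z2 ->]].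
have -> : right_word k.+3 = 0 :: behead (right_word k.+3) by [].
have [s [o E]] := foldl_step_push z1 0 [::] [::].
rewrite cat_cons -cat_rcons.
have E2 : foldl step231 ([::], [::]) (rcons z1 0 ++ behead (right_word k.+3)) =
    ([::] ++ left_word k.+2 ++ s, rcons o k.+2.*2.+1).
  by rewrite foldl_cat E foldl_step_right.
rewrite catA /SC_word stack_run231 foldl_cat E2.
(* Here 2 4 are on top, which takes at least two evens; hence the index [k.+3] of the right word. *)
have [t [u ->]] := @foldl_step_bottom [::] 4 2
  (behead (behead (left_word k.+2)) ++ s) (rcons o k.+2.*2.+1) z2 isT.
by apply/infixP; exists (u ++ t), s; rewrite -!catA.
Qed.

(** * The first two passes on the starting permutations *)

(* c+2 c+1 c+4 c+3 ... c+2k c+2k-1 *)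
Fixpoint swaps (c k : nat) : seq nat :=
  if k is k'.+1 then [:: c.+2, c.+1 & swaps c.+2 k'] else [::].

Lemma perm_swaps c k : perm_eq (swaps c k) (iota c.+1 k.*2).
Proof.
elim: k c => [|k IH] c //=.
by rewrite -cat1s -(cat1s c.+1) perm_catCA !perm_cons IH.
Qed.

(** Among three consecutive entries, if the first two rise then the third still exceeds the
    first. *)
Lemma swaps_cc y c k : y <= c -> ~~ cc (y :: swaps c k).
Proof.
elim: k y c => [|k IH] y c yc /=; first by rewrite cc_cons cc_nil.
rewrite cc_cons negb_or; apply/andP; split; first by lia.
rewrite cc_cons negb_or IH // andbT.
by case: k {IH} => //= k; lia.
Qed.

(** Each pair meets a top entry at most [c]: [c.+2] is pushed, then [c.+1] lies strictly between the
    two and expels it. *)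
Lemma foldl_step_swaps y c k s o : y <= c ->
  foldl step231 (y :: s, o) (swaps c k) =
    (catrev (skip2 c.+1 k) (y :: s), o ++ skip2 c.+2 k).
Proof.
elim: k y c s o => [|k IH] y c s o yc; first by rewrite cats0.
have E : step231 (step231 (y :: s, o) c.+2) c.+1 = (c.+1 :: y :: s, rcons o c.+2).
  rewrite {2}/step231; case: s => [|b r] /=; last case: ifP => [|_]; try lia.
    by rewrite /step231 /= !ltnS yc leqnn.
  by rewrite /step231 /= !ltnS yc leqnn.
by rewrite /= E IH // cat_rcons.
Qed.

Lemma foldl_step_swaps0 k :
  foldl step231 ([::], [::]) (0 :: swaps 0 k) = (rev (0 :: odds k), evens k).
Proof.
by rewrite [foldl _ _ _]foldl_step_swaps // catrevE rev_cons cats1.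
Qed.

Lemma SCw_swaps k : SCw (0 :: swaps 0 k) = left_word k.
Proof. exact: SCw_run _ _ _ (foldl_step_swaps0 k). Qed.

Lemma SCw_rev_swaps k : SCw (rev (0 :: swaps 0 k)) = 0 :: swaps 0 k.
Proof. by rewrite SCw_rev revK // swaps_cc. Qed.

(** The maximum [2k+1] comes last and pops nothing, so it only extends the odds kept on the
    stack. *)
Lemma SCw_swaps_rcons k :
  SCw (rcons (0 :: swaps 0 k) k.*2.+1) = rev (right_word k.+1).
Proof.
rewrite (SCw_run _ (rev (0 :: odds k.+1)) (evens k)).
  by rewrite /right_word -cat_cons rev_cat revK.
rewrite foldl_rcons foldl_step_swaps0.
case: k => [|k] //.
rewrite !(skip2_rcons 1) -!rcons_cons !rev_rcons step231_push //; lia.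
Qed.

(** After the peak 2k+3 all entries are below 2k+2, which lies under it on the stack, so nothing is
    popped. *)
Lemma SCw_rev_right_word k : SCw (rev (right_word k.+2)) = right_word k.+2.
Proof.
have -> : rev (right_word k.+2) =
    2 :: skip2 4 k ++ k.+1.*2.+1 :: rev (odds k.+1) ++ [:: 0].
  rewrite /right_word -cat_cons rev_cat revK (skip2_rcons 1 k.+1) rev_cons.
  by rewrite rev_rcons -cats1.
rewrite -[RHS]cat0s; apply: SCw_run.
rewrite [foldl _ _ _]foldl_cat foldl_step_up ?path_skip2 //.
rewrite -[catrev _ _]/(catrev (evens k.+1) [::]) catrevE skip2_rcons rev_rcons.
set result := RHS; rewrite [foldl _ _ _]/= step231_push; last by lia.
rewrite foldl_cat foldl_step_down; last by apply: path_rev_skip2; lia.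
rewrite catrevE revK [foldl _ _ _]step231_0 /result /right_word !skip2_rcons.
by rewrite rev_rcons !cat_rcons cats0.
Qed.

(** * Stability of the avoidance class and sort-numbers *)

Lemma subseq132_contains b a x w :
  subseq [:: b; a; x] w -> b < x < a -> contains [:: 1; 3; 2] w.
Proof.
case/subseqP => m sm mE h; apply/existsP.
have sm' : size m == size w by rewrite sm.
exists (Tuple sm'); rewrite -mE; apply/same_orderP; split=> //.
by move=> [|[|[|i]]] [|[|[|j]]] //= _ _; lia.
Qed.

Lemma subseq231_contains b a x w :
  subseq [:: b; a; x] w -> x < b < a -> contains [:: 2; 3; 1] w.
Proof.
case/subseqP => m sm mE h; apply/existsP.
have sm' : size m == size w by rewrite sm.
by exists (Tuple sm'); rewrite -mE same_order231_of.
Qed.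

Lemma contains132_rev w :
  contains [:: 1; 3; 2] (rev w) = contains [:: 2; 3; 1] w.
Proof.
apply/existsP/existsP => [] [m].
  move/same_order132 => [b [a [x [E h]]]]; apply/existsP.
  apply: (@subseq231_contains x a b) => //.
  by rewrite -subseq_rev -[rev [:: _; _; _]]/[:: b; a; x] -E mask_subseq.
move/same_order231 => [b [a [x [E h]]]]; apply/existsP.
apply: (@subseq132_contains x a b) => //.
by rewrite -[[:: x; a; b]]/(rev [:: b; a; x]) subseq_rev -E mask_subseq.
Qed.

Lemma SC231_Av n (p : 'S_n) :
  p \in Av_132_231 n -> SC231 p \in Av_132_231 n.
Proof.
rewrite !inE => /andP [h132 h231].
have -> : word (SC231 p) = rev (word p).
  (* A consecutive 231 in the reversed word would be a 132 in [p]. *)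
  rewrite word_SC SCw_rev //; apply: contra h132 => /existsP [i].
  case/same_order231 => [b [a [x [E h]]]].
  apply: (@subseq132_contains x a b) => //.
  rewrite -subseq_rev -[rev [:: _; _; _]]/[:: b; a; x] -E.
  exact: subseq_trans (take_subseq _ _) (drop_subseq _ _).
rewrite /avoids contains132_rev -[X in _ && ~~ X]contains132_rev revK.
exact/andP.
Qed.

(** By stability, membership after some [j <= k] passes would persist up to pass [k]. *)
Lemma sort_number_gt n (p : 'S_n) k :
  iter k (@SC231 n) p \notin Av_132_231 n -> k < sort_number p.
Proof.
rewrite /sort_number; case: ex_minnP => j hj _; apply: contraNltn => jk.
by rewrite -(subnK jk) iterD; elim: (k - j) => [|i IH] //=; exact: SC231_Av.
Qed.

Lemma word_iter_SC231 n (p : 'S_n) k :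
  word (iter k (@SC231 n) p) = iter k SCw (word p).
Proof. by elim: k => [|k IH] //=; rewrite word_SC IH. Qed.

Lemma word_surj n w : perm_eq w (iota 0 n) -> exists p : 'S_n, word p = w.
Proof.
move=> hw.
have sz : size w = n by rewrite (perm_size hw) size_iota.
have uw : uniq w by rewrite (perm_uniq hw) iota_uniq.
have ltw i : i < n -> nth 0 w i < n.
  move=> hi; have : nth 0 w i \in iota 0 n.
    by rewrite -(perm_mem hw) mem_nth ?sz.
  by rewrite mem_iota.
have inj : injective (fun i : 'I_n => Ordinal (ltw i (ltn_ord i))).
  move=> i j [] /eqP; rewrite nth_uniq ?sz // => /eqP; exact: val_inj.
exists (perm inj); apply: (@eq_from_nth _ 0); rewrite size_word // => i hi.
by rewrite -[i]/(val (Ordinal hi)) nth_word permE.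
Qed.

(** * Counting passes *)

Lemma iter_right_word_contains132 j w :
  infix (right_word j.+2) w ->
  contains [:: 1; 3; 2] (iter j.*2 SCw w).
Proof.
elim: j w => [|j IH] w h.
  (* [right_word 2] is 0 1 3 2. *)
  apply: (@subseq132_contains 1 3 2) => //.
  by apply: subseq_trans (infixW h).
(* Two passes lower the index by one. *)
by rewrite doubleS !iterSr; apply/IH/SCw_left_word/SCw_right_word.
Qed.

Lemma max_sort_number_gt n w k : perm_eq w (iota 0 n) ->
  contains [:: 1; 3; 2] (iter k SCw w) ->
  k < max_sort_number n.
Proof.
move=> /word_surj [p <-]; rewrite -word_iter_SC231 => h.
apply: leq_trans (leq_bigmax p); apply: sort_number_gt.
by rewrite inE /avoids h.
Qed.

Theorem theorem4p2 (n : nat) (hn : 3 <= n) : n - 1 <= max_sort_number n.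
Proof.
have [m m_gt0 ->] : exists2 m, 0 < m & n = m.+2 by exists (n - 2); lia.
have perm_swaps0 k : perm_eq (0 :: swaps 0 k) (iota 0 k.*2.+1).
  by rewrite /= perm_cons perm_swaps.
rewrite subn1 -(odd_double_half m) in m_gt0 *.
case: (odd m) m./2 m_gt0 => [] [|k] // _.
(* n = 3: the word 1 2 0 goes to 0 2 1, itself a 132. *)
- apply: (@max_sort_number_gt _ (rev (0 :: swaps 0 1))).
    by rewrite perm_rev.
  by rewrite [iter _ _ _]SCw_rev_swaps; apply: (@subseq132_contains 0 2 1).
(* n = 2k+5: two passes give [left_word k.+2], a third [right_word k.+2], and 2k of the n-2 passes
   remain. *)
- apply: (@max_sort_number_gt _ (rev (0 :: swaps 0 k.+2))).
    by rewrite perm_rev.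
  rewrite add1n doubleS !iterSr SCw_rev_swaps SCw_swaps.
  by apply/iter_right_word_contains132/SCw_left_word/infix_refl.
(* n = 2k+4: two passes give [right_word k.+2], and again 2k remain. *)
- apply: (@max_sort_number_gt _ (rcons (0 :: swaps 0 k.+1) k.+1.*2.+1)).
    by rewrite -[_.+2]addn1 iotaD -cats1 perm_cat.
  rewrite add0n doubleS !iterSr SCw_swaps_rcons SCw_rev_right_word.
  exact/iter_right_word_contains132/infix_refl.
Qed.
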